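(* In the Ore algebra $\mathbb{Q}[n]\langle S\rangle$ consider the three order-$3$ operators $L_3=A_0(n)+A_1(n)S+A_2(n)S^2+A_3(n)S^3$ (each encoding the recurrence $\sum_{i=0}^3A_i(n)f(n+i)=0$): $L_3^{(\pi,1)}$: $$A_0=-4-8n-6n^2-2n^3-\tfrac{n^4}{4},\quad A_1=\tfrac{81}{4}+\tfrac{173n}{4}+\tfrac{65n^2}{2}+\tfrac{21n^3}{2}+\tfrac{5n^4}{4},$$ $$A_2=-\tfrac{137}{4}-\tfrac{297n}{4}-\tfrac{111n^2}{2}-\tfrac{35n^3}{2}-2n^4,\quad A_3=18+39n+29n^2+9n^3+n^4;$$ $L_3^{(\pi,2)}$: $$A_0=-\tfrac{35}{9}-\tfrac{26n}{3}-\tfrac{23n^2}{3}-\tfrac{121n^3}{36}-\tfrac{35n^4}{48}-\tfrac{n^5}{16},$$ $$A_1=-\tfrac{365}{9}-\tfrac{181n}{2}-\tfrac{1879n^2}{24}-\tfrac{1589n^3}{48}-\tfrac{55n^4}{8}-\tfrac{9n^5}{16},$$ $$A_2=-\tfrac{356}{9}-\tfrac{503n}{6}-\tfrac{1633n^2}{24}-\tfrac{1279n^3}{48}-\tfrac{81n^4}{16}-\tfrac{3n^5}{8},$$ $$A_3=84+183n+154n^2+\tfrac{568n^3}{9}+\tfrac{38n^4}{3}+n^5;$$ $L_3^{(G)}$: $$A_0=-\tfrac32-\tfrac{5n}{4}-\tfrac{n^2}{4},\quad A_1=\tfrac{21}{2}+\tfrac{29n}{4}+\tfrac{5n^2}{4},\quad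 A_2=-\tfrac{85}{4}-13n-2n^2,\quad A_3=\tfrac{49}{4}+7n+n^2.$$ Each of the three satisfies $A_0(n)+A_1(n)+A_2(n)+A_3(n)=0$ identically, and therefore factors as a shifted summation lift of an order-$2$ kernel. More precisely: (i) $L^{(\pi,1)}_3=\frac14\,\sigma\bigl(L^{(1)}_2(S-1)\bigr)$ with $$L^{(1)}_2=(n+1)^4-n(2n+3)(2n^2+6n+5)S+4n(n+1)(n+2)^2S^2.$$ If $(c_n)$ is annihilated by $L_2^{(1)}$ and $u_n:=4^n(n-1)!(n!)^2c_n$ for $n\ge1$, then $$u_{n+1}=(2n+1)(2n^2+2n+1)u_n-4n^6u_{n-1}\qquad(n\ge2),$$ equivalently the inflated kernel is represented by the polynomial continued fraction $\operatorname{PCF}\bigl((2n+1)(2n^2+2n+1),-4n^6\bigr)$. (ii) $L^{(\pi,2)}_3=\frac1{144}\,\sigma\bigl(L^{(2)}_2(S-1)\bigr)$ with $$L^{(2)}_2=(n+1)^3(3n+4)(3n+7)+(2n+3)(3n+1)(3n+7)(5n^2+15n+12)S+16(n+2)^3(3n+1)(3n+4)S^2.$$ (iii) $L^{(G)}_3=\frac14\,\sigma\bigl(L^{(G)}_2(S-1)\bigr)$ with $$L^{(G)}_2=(n+1)(n+2)-4(n+2)^2S+(2n+5)^2S^2,$$ equivalently, in recurrence form, $(2n+5)^2g_{n+2}-4(n+2)^2g_{n+1}+(n+1)(n+2)g_n=0$.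
   Context: $\mathbb{Q}[n]\langle S\rangle$ is the Ore algebra in which $S$ is the forward shift, with $S\,p(n)=p(n+1)\,S$ for $p\in\mathbb{Q}[n]$; $S$ acts on sequences by $(Sf)(n)=f(n+1)$, and a sequence is annihilated by an operator if the operator applied to it is zero. The map $\sigma$ is the automorphism $p(n)\mapsto p(n+1)$ applied to the coefficients of an operator. The three order-$3$ operators are those explicitly printed in Appendix B.6 of the preprint of Raz, Shalyt, Leibtag, Kalisch, Weinbaum, Hadad and Kaminer (two recurrences for formulas for $\pi$, one for Catalan's constant). The phrase ''represented by $\operatorname{PCF}(a(n),b(n))$'' means that the sequence satisfies the second-order recurrence $u_{n+1}=a(n)u_n+b(n)u_{n-1}$ associated with the polynomial continued fraction with partial denominators $a(n)$ and partial numerators $b(n)$. *)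

(* Defs.v *)
From HB Require Import structures.
From mathcomp Require Import all_boot all_order all_algebra.

Set Implicit Arguments.
Unset Strict Implicit.
Unset Printing Implicit Defensive.

Import Order.TTheory GRing.Theory Num.Theory.
Local Open Scope ring_scope.

Definition pshift (p : {poly rat}) : {poly rat} := p \Po ('X + 1%:P).

Lemma pshift_is_zmod_morphism : zmod_morphism pshift.
Proof. by move=> p q; rewrite /pshift raddfB. Qed.

Lemma pshift_is_monoid_morphism : monoid_morphism pshift.
Proof. by split=> [|p q]; rewrite /pshift ?rmorph1 ?rmorphM. Qed.

HB.instance Definition _ :=
  GRing.isZmodMorphism.Build {poly rat} {poly rat} pshift
    pshift_is_zmod_morphism.
HB.instance Definition _ :=
  GRing.isMonoidMorphism.Build {poly rat} {poly rat} pshift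
    pshift_is_monoid_morphism.

(* The Ore algebra Q[n]<S>.  The element p_0 + p_1 S + ... + p_d S^d, with the
   coefficients on the left, is stored as the polynomial whose i-th coefficient
   is p_i : {poly rat}, the inner variable 'X being n.  Sum and left scaling by
   Q[n] are those of {poly {poly rat}}; the product is twisted by S p = p(n+1) S.
   In this left algebra p *: S ^+ i is the monomial p S^i, and p%:A is the
   operator of multiplication by p. *)
Definition ore : Type := {poly {poly rat}}.

HB.instance Definition _ := GRing.Lmodule.copy ore {poly {poly rat}}.

Definition ore_poly (L : ore) : {poly {poly rat}} := L.
Definition poly_ore (p : {poly {poly rat}}) : ore := p.

Definition coef_ore (L : ore) (i : nat) : {poly rat} := (ore_poly L)`_i.

(* For L != 0; the order of 0 is set to 0. *)
Definition order_ore (L : ore) : nat := (size (ore_poly L)).-1.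

Definition shift : ore := poly_ore 'X.

(* p(n) |-> p(n+1) on each coefficient. *)
Definition sigma (L : ore) : ore := poly_ore (map_poly pshift (ore_poly L)).

(* (\sum_i p_i S^i) M, with S^i M = sigma^i(M) S^i. *)
Definition mul_ore (L M : ore) : ore :=
  \sum_(i < size (ore_poly L))
    coef_ore L i *: poly_ore ('X^i * ore_poly (iter i sigma M)).

Section OreRing.

Let T (M : ore) : ore := poly_ore ('X * ore_poly (sigma M)).

Local Lemma sigmaD (M N : ore) : sigma (M + N) = sigma M + sigma N.
Proof. exact: (rmorphD (map_poly pshift)). Qed.

Local Lemma sigma0 : sigma 0 = 0.
Proof. exact: (rmorph0 (map_poly pshift)). Qed.

Local Lemma sigmaZ p (M : ore) : sigma (p *: M) = pshift p *: sigma M.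
Proof. exact: map_polyZ. Qed.

Local Lemma TD (M N : ore) : T (M + N) = T M + T N.
Proof. by rewrite /T sigmaD; exact: (mulrDr ('X : {poly {poly rat}})). Qed.

Local Lemma T0 : T 0 = 0.
Proof. by rewrite /T sigma0; exact: (mulr0 ('X : {poly {poly rat}})). Qed.

Local Lemma TZ p (M : ore) : T (p *: M) = pshift p *: T M.
Proof.
by rewrite /T sigmaZ; symmetry; exact: (scalerAr (pshift p) ('X : {poly _})).
Qed.

Local Lemma iterT i (M : ore) :
  iter i T M = poly_ore ('X^i * ore_poly (iter i sigma M)).
Proof.
elim: i => [|i IH] /=; first by rewrite /poly_ore expr0 mul1r.
rewrite IH /T /sigma /ore_poly /poly_ore rmorphM /= map_polyXn mulrA -exprS.
by [].
Qed.

Local Lemma iterTD i (M N : ore) : iter i T (M + N) = iter i T M + iter i T N.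
Proof. by elim: i => //= i ->; rewrite TD. Qed.

Local Lemma iterT0 i : iter i T 0 = 0.
Proof. by elim: i => //= i ->; rewrite T0. Qed.

Local Lemma mulE (L M : ore) n : (size (ore_poly L) <= n)%N ->
  mul_ore L M = \sum_(i < n) coef_ore L i *: iter i T M.
Proof.
pose F i : ore := coef_ore L i *: poly_ore ('X^i * ore_poly (iter i sigma M)).
move=> le_n; rewrite /mul_ore (big_ord_widen _ F le_n).
rewrite big_mkcond; apply: eq_bigr => i _; rewrite iterT; case: ltnP => // hi.
by rewrite /coef_ore nth_default // scale0r.
Qed.

Local Lemma mulDl : left_distributive mul_ore +%R.
Proof.
move=> L M N; pose n := maxn (size (ore_poly L)) (size (ore_poly M)).
have hL : (size (ore_poly L) <= n)%N by rewrite leq_maxl.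
have hM : (size (ore_poly M) <= n)%N by rewrite leq_maxr.
have hD : (size (ore_poly (L + M)%R) <= n)%N.
  exact: (size_polyD (ore_poly L) (ore_poly M)).
rewrite (mulE _ hL) (mulE _ hM) (mulE _ hD) -big_split /=.
apply: eq_bigr => i _; rewrite -scalerDl; congr (_ *: _).
exact: (coefD (ore_poly L) (ore_poly M)).
Qed.

Local Lemma mulDr : right_distributive mul_ore +%R.
Proof.
move=> L M N; rewrite !(mulE _ (leqnn _)) -big_split /=.
by apply: eq_bigr => i _; rewrite iterTD scalerDr.
Qed.

Local Lemma mulZl p (L M : ore) : p *: mul_ore L M = mul_ore (p *: L) M.
Proof.
have hL : (size (ore_poly (p *: L)) <= size (ore_poly L))%N.
  exact: (size_scale_leq p (ore_poly L)).
rewrite (mulE _ hL) (mulE _ (leqnn _)) scaler_sumr.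
apply: eq_bigr => i _; rewrite scalerA; congr (_ *: _).
by rewrite /coef_ore -(coefZ p (ore_poly L)).
Qed.

Local Lemma Tsum (I : Type) (r : seq I) (P : pred I) (F : I -> ore) :
  T (\sum_(i <- r | P i) F i) = \sum_(i <- r | P i) T (F i).
Proof. by apply: (big_morph T TD T0). Qed.

Local Lemma coefT0 (L : ore) : coef_ore (T L) 0 = 0.
Proof. by rewrite /coef_ore /T /ore_poly /poly_ore coefXM. Qed.

Local Lemma coefTS (L : ore) i : coef_ore (T L) i.+1 = pshift (coef_ore L i).
Proof. by rewrite /coef_ore /T /sigma /ore_poly /poly_ore coefXM /= coef_map. Qed.

Local Lemma mulTl (L M : ore) : mul_ore (T L) M = T (mul_ore L M).
Proof.
have hL : (size (ore_poly (T L)) <= (size (ore_poly L)).+1)%N.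
  rewrite /T /ore_poly /poly_ore; apply: leq_trans (size_polyMleq _ _) _.
  by rewrite size_polyX /= ltnS size_poly.
rewrite (mulE _ hL) (mulE _ (leqnn _)) Tsum big_ord_recl /=.
rewrite coefT0 scale0r add0r; apply: eq_bigr => i _.
by rewrite coefTS TZ.
Qed.

Local Lemma mul0l (M : ore) : mul_ore 0 M = 0.
Proof. by rewrite (@mulE 0 M 0) ?big_ord0 // /ore_poly size_poly0. Qed.

Local Lemma mulA : associative mul_ore.
Proof.
move=> L M N; symmetry; rewrite (mulE M (leqnn (size (ore_poly L)))).
rewrite (mulE (mul_ore M N) (leqnn (size (ore_poly L)))).
rewrite (big_morph (mul_ore^~ N) (fun x y => mulDl x y N) (mul0l N)).
apply: eq_bigr => i _; rewrite -mulZl; congr (_ *: _).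
by elim: (i : nat) => //= k IH; rewrite mulTl IH.
Qed.

Let one : ore := poly_ore 1.

Local Lemma mul1l : left_id one mul_ore.
Proof.
move=> M; rewrite (@mulE one M 1) /one /ore_poly /poly_ore ?size_poly1 //.
by rewrite big_ord1 /= /coef_ore /ore_poly coef1 /= scale1r.
Qed.

Local Lemma mulr_one : right_id one mul_ore.
Proof.
move=> M; rewrite (mulE _ (leqnn _)).
have h1 i : iter i T one = poly_ore 'X^i.
  rewrite iterT; have -> : iter i sigma one = one; last by rewrite /one /poly_ore mulr1.
  by elim: i => //= i ->; rewrite /sigma /one /ore_poly /poly_ore rmorph1.
rewrite -[RHS](coefK (ore_poly M)) poly_def.
by apply: eq_bigr => i _; rewrite h1.
Qed.

Local Lemma one_neq0 : one != 0.
Proof. exact: (oner_neq0 {poly {poly rat}}). Qed.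

HB.instance Definition _ :=
  GRing.Zmodule_isNzRing.Build ore mulA mul1l mulr_one mulDl mulDr one_neq0.

HB.instance Definition _ :=
  GRing.Lmodule_isLalgebra.Build {poly rat} ore mulZl.

End OreRing.

Lemma mul_shiftl (M : ore) :
  shift * M = poly_ore ('X * ore_poly (sigma M)).
Proof.
rewrite [LHS]/GRing.mul /= /mul_ore /shift {1}/ore_poly {1}/poly_ore size_polyX.
rewrite big_ord_recl big_ord1 /coef_ore /ore_poly /poly_ore !coefX /=.
by rewrite scale0r add0r scale1r expr1.
Qed.

Lemma shift_comm (p : {poly rat}) : shift * p%:A = pshift p *: shift.
Proof.
have mapA : sigma p%:A = pshift p *: (1 : ore).
  transitivity (poly_ore (pshift p *: map_poly pshift 1)); first exact: map_polyZ.
  by rewrite rmorph1.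
rewrite mul_shiftl mapA.
transitivity (poly_ore (pshift p *: ('X * 1))); last by rewrite mulr1.
by symmetry; exact: (scalerAr (pshift p) ('X : {poly {poly rat}}) 1).
Qed.

Lemma shiftXE i : shift ^+ i = poly_ore 'X^i.
Proof.
elim: i => [|i IH]; first by rewrite !expr0.
by rewrite exprS IH mul_shiftl /sigma /ore_poly /poly_ore map_polyXn -exprS.
Qed.

Lemma ore_monomialE (L : ore) :
  L = \sum_(i < size (ore_poly L)) coef_ore L i *: shift ^+ i.
Proof.
rewrite -[LHS](coefK (ore_poly L)) poly_def.
by apply: eq_bigr => i _; rewrite shiftXE.
Qed.

(* The action on a sequence f = (f(0), f(1), ...), with (S f)(n) = f(n+1). *)
Definition act (K : numFieldType) (L : ore) (f : nat -> K) (n : nat) : K :=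
  \sum_(i < (order_ore L).+1) ratr (coef_ore L i).[n%:R] * f (n + i)%N.

Lemma actE (K : numFieldType) (L : ore) (f : nat -> K) (n m : nat) :
  (size (ore_poly L) <= m)%N ->
  act L f n = \sum_(i < m) ratr (coef_ore L i).[n%:R] * f (n + i)%N.
Proof.
pose F i := ratr (coef_ore L i).[n%:R] * f (n + i)%N.
have F0 i : (size (ore_poly L) <= i)%N -> F i = 0.
  by move=> le_i; rewrite /F /coef_ore nth_default // horner0 rmorph0 mul0r.
have wid k l : (size (ore_poly L) <= k)%N -> (k <= l)%N ->
    \sum_(i < k) F i = \sum_(i < l) F i.
  move=> le_k le_kl; rewrite (big_ord_widen _ F le_kl) big_mkcond.
  apply: eq_bigr => i _; case: ltnP => // le_ki.
  by rewrite F0 // (leq_trans le_k).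
move=> le_m; have le_o : (size (ore_poly L) <= (order_ore L).+1)%N by exact: leqSpred.
have := leq_maxr (order_ore L).+1 m; have := leq_maxl (order_ore L).+1 m.
by move=> /(wid _ _ le_o) e1 /(wid _ _ le_m) e2; rewrite /act e1 -e2.
Qed.

Lemma actD (K : numFieldType) (L M : ore) (f : nat -> K) n :
  act (L + M) f n = act L f n + act M f n.
Proof.
pose m := maxn (size (ore_poly L)) (size (ore_poly M)).
have hD : (size (ore_poly (L + M)%R) <= m)%N.
  exact: (size_polyD (ore_poly L) (ore_poly M)).
rewrite (actE _ _ (leq_maxl _ _ : (_ <= m)%N)) (actE _ _ hD).
rewrite (actE _ _ (leq_maxr _ _ : (_ <= m)%N)) -big_split /=.
apply: eq_bigr => i _; rewrite -mulrDl -rmorphD -hornerD.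
by congr (ratr _.[_] * _); exact: (coefD (ore_poly L) (ore_poly M)).
Qed.

Lemma actZ (K : numFieldType) p (L : ore) (f : nat -> K) n :
  act (p *: L) f n = ratr p.[n%:R] * act L f n.
Proof.
have hL : (size (ore_poly (p *: L)) <= size (ore_poly L))%N.
  exact: (size_scale_leq p (ore_poly L)).
rewrite (actE _ _ hL) (actE _ _ (leqnn _)) mulr_sumr.
apply: eq_bigr => i _; rewrite mulrA -rmorphM -hornerM.
by congr (ratr _.[_] * _); exact: (coefZ p (ore_poly L)).
Qed.

Lemma act0 (K : numFieldType) (f : nat -> K) n : act 0 f n = 0.
Proof. by rewrite -[0 in LHS](scale0r (0 : ore)) actZ horner0 rmorph0 mul0r. Qed.

Lemma act_shift_mul (K : numFieldType) (M : ore) (f : nat -> K) n :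
  act (shift * M) f n = act M f n.+1.
Proof.
have hM : (size (ore_poly (shift * M)%R) <= (size (ore_poly M)).+1)%N.
  rewrite mul_shiftl /ore_poly /poly_ore; apply: leq_trans (size_polyMleq _ _) _.
  by rewrite size_polyX /= ltnS size_poly.
have c0 : coef_ore (shift * M) 0 = 0.
  by rewrite mul_shiftl /coef_ore /ore_poly /poly_ore coefXM.
have cS i : coef_ore (shift * M) i.+1 = pshift (coef_ore M i).
  by rewrite mul_shiftl /coef_ore /sigma /ore_poly /poly_ore coefXM /= coef_map.
rewrite (actE _ _ hM) (actE _ _ (leqnn _)) big_ord_recl /= c0.
rewrite horner0 rmorph0 mul0r add0r; apply: eq_bigr => i _ /=.
rewrite cS /pshift horner_comp hornerD hornerX hornerC natr1.
by rewrite /bump leq0n addnA addn1.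
Qed.

Lemma act_mul (K : numFieldType) (L M : ore) (f : nat -> K) n :
  act (L * M) f n = act L (act M f) n.
Proof.
rewrite {1}(ore_monomialE L) mulr_suml [RHS](actE _ _ (leqnn _)).
rewrite (big_morph (fun N => act N f n) (fun A B => actD A B f n) (act0 f n)).
apply: eq_bigr => i _; rewrite -scalerAl actZ; congr (_ * _).
elim: (i : nat) n => [|k IH] m; first by rewrite expr0 mul1r addn0.
by rewrite exprS -mulrA act_shift_mul IH addnS addSn.
Qed.

Definition annihilated (K : numFieldType) (L : ore) (f : nat -> K) : Prop :=
  forall n : nat, act L f n = 0.

(* The sequence u is indexed from n0; u(n-1) makes sense only for n > n0, and
   the values of u below n0 are irrelevant. *)
Definition represented_by_PCF (K : numFieldType) (a b : {poly rat})
    (n0 : nat) (u : nat -> K) : Prop :=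
  forall n : nat, (n0 < n)%N ->
    u n.+1 = ratr a.[n%:R] * u n + ratr b.[n%:R] * u n.-1.

Section Operators.

Let n : {poly rat} := 'X.

Definition L3_pi1 : ore :=
    ((-4)%:P - 8 *: n - 6 *: n ^+ 2 - 2 *: n ^+ 3 - (1 / 4) *: n ^+ 4)%:A
  + ((81 / 4)%:P + (173 / 4) *: n + (65 / 2) *: n ^+ 2 + (21 / 2) *: n ^+ 3
     + (5 / 4) *: n ^+ 4) *: shift
  + ((- (137 / 4))%:P - (297 / 4) *: n - (111 / 2) *: n ^+ 2
     - (35 / 2) *: n ^+ 3 - 2 *: n ^+ 4) *: shift ^+ 2
  + (18%:P + 39 *: n + 29 *: n ^+ 2 + 9 *: n ^+ 3 + n ^+ 4) *: shift ^+ 3.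

Definition L3_pi2 : ore :=
    ((- (35 / 9))%:P - (26 / 3) *: n - (23 / 3) *: n ^+ 2
     - (121 / 36) *: n ^+ 3 - (35 / 48) *: n ^+ 4 - (1 / 16) *: n ^+ 5)%:A
  + ((- (365 / 9))%:P - (181 / 2) *: n - (1879 / 24) *: n ^+ 2
     - (1589 / 48) *: n ^+ 3 - (55 / 8) *: n ^+ 4
     - (9 / 16) *: n ^+ 5) *: shift
  + ((- (356 / 9))%:P - (503 / 6) *: n - (1633 / 24) *: n ^+ 2
     - (1279 / 48) *: n ^+ 3 - (81 / 16) *: n ^+ 4
     - (3 / 8) *: n ^+ 5) *: shift ^+ 2
  + (84%:P + 183 *: n + 154 *: n ^+ 2 + (568 / 9) *: n ^+ 3
     + (38 / 3) *: n ^+ 4 + n ^+ 5) *: shift ^+ 3.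

Definition L3_G : ore :=
    ((- (3 / 2))%:P - (5 / 4) *: n - (1 / 4) *: n ^+ 2)%:A
  + ((21 / 2)%:P + (29 / 4) *: n + (5 / 4) *: n ^+ 2) *: shift
  + ((- (85 / 4))%:P - 13 *: n - 2 *: n ^+ 2) *: shift ^+ 2
  + ((49 / 4)%:P + 7 *: n + n ^+ 2) *: shift ^+ 3.

Definition L2_1 : ore :=
    ((n + 1) ^+ 4)%:A
  - (n * (2 * n + 3) * (2 * n ^+ 2 + 6 * n + 5)) *: shift
  + (4 * n * (n + 1) * (n + 2) ^+ 2) *: shift ^+ 2.

Definition L2_2 : ore :=
    ((n + 1) ^+ 3 * (3 * n + 4) * (3 * n + 7))%:A
  + ((2 * n + 3) * (3 * n + 1) * (3 * n + 7)
     * (5 * n ^+ 2 + 15 * n + 12)) *: shift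
  + (16 * (n + 2) ^+ 3 * (3 * n + 1) * (3 * n + 4)) *: shift ^+ 2.

Definition L2_G : ore :=
    ((n + 1) * (n + 2))%:A
  - (4 * (n + 2) ^+ 2) *: shift
  + ((2 * n + 5) ^+ 2) *: shift ^+ 2.

End Operators.

(* Main.v *)
Require Import Defs.
From HB Require Import structures.
From mathcomp Require Import all_boot all_order all_algebra.
From mathcomp Require Import ring.

Set Implicit Arguments.
Unset Strict Implicit.
Unset Printing Implicit Defensive.

Import Order.TTheory GRing.Theory Num.Theory.
Local Open Scope ring_scope.

(** Since [shift - 1] has constant coefficients, right multiplication by it does
    not see the commutation rule of the Ore algebra: on coefficients it is
    multiplication by ['X - 1] in commutative polynomials ([mul_shift_sub1]).
    Hence for a kernel M of order 2 with coefficients a, b, c, the lift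
    M (S - 1) has coefficients -a, a - b, b - c, c, so its order is 3 and its
    coefficients sum to zero; [sigma] changes neither fact, as it acts on each
    coefficient by an injective ring morphism ([pshift_inj]).
    The three factorizations are thus four polynomial identities each
    ([sigma_lift_ore_of_seq3]), and the common claim on the three operators
    follows from the factorizations, with the rational constant moved into the
    kernel ([sigma_lift_order2]).

    For the continued fraction, let w(n) = 4^n (n-1)! n!^2 be the weight.  As
    w(n+1) = 4 n (n+1)^2 w(n) for n > 0 ([weightS]), the three terms of the
    recurrence for u = w c at n+1 are multiples of w(n), and its two sides
    differ by exactly 4 (n+1)^2 w(n) times the relation that annihilation of c
    gives at index n ([annihilated_L2_1_inflated]). *)

(** Polynomial identities with fractional coefficients are proved by comparing
    values: a nonzero polynomial has fewer roots than its size.  This moves them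
    into the field of rationals, where denominators can be cleared. *)
Lemma poly_eq_on_nat (p q : {poly rat}) :
  (forall m : nat, p.[m%:R] = q.[m%:R]) -> p = q.
Proof.
move=> eq_pq; apply/eqP; rewrite -subr_eq0; apply/negPn/negP => nz.
pose rs := [seq (i%:R : rat) | i <- iota 0 (size (p - q))].
have: (size rs < size (p - q)%R)%N.
  apply: max_poly_roots => //.
    by apply/allP => _ /mapP[i _ ->]; rewrite rootE !hornerE eq_pq subrr.
  by rewrite map_inj_uniq ?iota_uniq // => i j /eqP; rewrite eqr_nat => /eqP.
by rewrite size_map size_iota ltnn.
Qed.

Lemma pshift_horner p x : (pshift p).[x] = p.[x + 1].
Proof. by rewrite /pshift horner_comp !hornerE. Qed.

Lemma pshiftC (c : rat) : pshift c%:P = c%:P.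
Proof. exact: comp_polyC. Qed.

Lemma pshift_inj : injective pshift.
Proof.
apply: raddf_inj => p /eqP; rewrite -size_poly_eq0 size_comp_poly2.
  by rewrite size_poly_eq0 => /eqP.
exact: size_XaddC.
Qed.

(** An operator given by its list of left coefficients.  In this form degrees,
    coefficients and the action on sequences are read off the list. *)
Definition ore_of_seq (s : seq {poly rat}) : ore := poly_ore (Poly s).

Lemma ore_of_seqE s : ore_of_seq s = \sum_(i < size s) s`_i *: shift ^+ i.
Proof.
have -> : ore_of_seq s = poly_ore (\sum_(i < size s) s`_i *: 'X^i).
  rewrite /ore_of_seq -poly_def; congr poly_ore; apply/polyP => i.
  by rewrite coef_Poly coef_poly; case: ltnP => // h; rewrite nth_default.
by rewrite /poly_ore; apply: eq_bigr => i _; rewrite shiftXE.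
Qed.

Lemma ore_of_seq3E a b c :
  a%:A + b *: shift + c *: shift ^+ 2 = ore_of_seq [:: a; b; c].
Proof. by rewrite ore_of_seqE !big_ord_recr big_ord0 /= add0r expr0 expr1. Qed.

Lemma ore_of_seq4E a b c d :
  a%:A + b *: shift + c *: shift ^+ 2 + d *: shift ^+ 3 =
  ore_of_seq [:: a; b; c; d].
Proof. by rewrite ore_of_seqE !big_ord_recr big_ord0 /= add0r expr0 expr1. Qed.

Lemma order_ore_of_seq p s :
  last p s != 0 -> order_ore (ore_of_seq (p :: s)) = size s.
Proof.
by move=> nz; rewrite /order_ore /ore_of_seq /ore_poly /poly_ore (@PolyK _ p).
Qed.

Lemma act_ore_of_seq (K : numFieldType) s (f : nat -> K) n :
  act (ore_of_seq s) f n = \sum_(i < size s) ratr (s`_i).[n%:R] * f (n + i)%N.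
Proof.
rewrite (actE _ _ (size_Poly s : (size (ore_poly (ore_of_seq s)) <= size s)%N)).
by apply: eq_bigr => i _; congr (ratr _.[_] * _); exact: coef_Poly.
Qed.

(** The coefficients of [shift - 1] are constants, which the powers of the shift
    cross unchanged; so the twist disappears and the product is the one of
    commutative polynomials.  Degrees and values at 1 follow from this. *)
Lemma mul_shift_sub1 (M : ore) :
  M * (shift - 1) = poly_ore (ore_poly M * ('X - 1)).
Proof.
have MS : M * shift = poly_ore (ore_poly M * 'X).
  rewrite {1}[M]ore_monomialE mulr_suml.
  rewrite -[in RHS](coefK (ore_poly M)) poly_def mulr_suml.
  apply: eq_bigr => i _; rewrite -scalerAl -exprSr shiftXE.
  by rewrite exprSr; exact: (scalerAl _ 'X^i ('X : {poly {poly rat}})).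
rewrite mulrBr mulr1 MS; symmetry.
by rewrite mulrBr mulr1.
Qed.

Lemma scale_sigma_lift (e : rat) (M : ore) :
  e%:P *: sigma (M * (shift - 1)) = sigma ((e%:P *: M) * (shift - 1)).
Proof. by rewrite -scalerAl Defs.sigmaZ pshiftC. Qed.

Lemma coef_ore_of_seq s i : coef_ore (ore_of_seq s) i = s`_i.
Proof. exact: coef_Poly. Qed.

Lemma coef_sigma_lift (M : ore) i :
  coef_ore (sigma (M * (shift - 1))) i =
  pshift ((if i == 0%N then 0 else coef_ore M i.-1) - coef_ore M i).
Proof.
rewrite mul_shift_sub1 /coef_ore /sigma /ore_poly /poly_ore coef_map /=.
by rewrite mulrBr mulr1 coefB coefMX.
Qed.

Lemma sigma_lift_ore_of_seq3 e a b c :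
  e%:P *: sigma (ore_of_seq [:: a; b; c] * (shift - 1)) =
  ore_of_seq [:: e%:P * - pshift a; e%:P * (pshift a - pshift b);
              e%:P * (pshift b - pshift c); e%:P * pshift c].
Proof.
apply/polyP => i; rewrite -[RHS]/(coef_ore (ore_of_seq _) i) coef_ore_of_seq.
apply: etrans (coefZ _ (sigma _ : {poly {poly rat}}) i) _.
rewrite -[X in _ * X]/(coef_ore (sigma _) i) coef_sigma_lift !coef_ore_of_seq.
case: i => [|[|[|[|i]]]] /=;
  by rewrite ?nth_nil ?sub0r ?subr0 ?raddfB ?raddfN ?raddf0 ?mulr0.
Qed.

Lemma order_sigma_lift (M : ore) : (0 < order_ore M)%N ->
  order_ore (sigma (M * (shift - 1))) = (order_ore M).+1.
Proof.
rewrite mul_shift_sub1 /order_ore /sigma /ore_poly /poly_ore => M_gt0.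
have M_neq0 : (M : {poly {poly rat}}) != 0.
  by apply: contraTneq M_gt0 => ->; rewrite size_poly0.
rewrite (size_map_inj_poly pshift_inj (raddf0 _)).
rewrite size_Mmonic ?monicXsubC // size_XsubC addn2 /= prednK //.
by rewrite size_poly_gt0.
Qed.

(** The sum of the coefficients is the value of the underlying commutative
    polynomial at 1, a root of the factor ['X - 1].  The bound [d] lets the sum
    run past the order, over zero coefficients. *)
Lemma sum_coef_sigma_lift (M : ore) d : (order_ore M < d)%N ->
  \sum_(i < d.+1) coef_ore (sigma (M * (shift - 1))) i = 0.
Proof.
move=> lt_d; rewrite mul_shift_sub1 /sigma /poly_ore.
set L : {poly {poly rat}} := map_poly _ _.
have size_L : (size L <= d.+1)%N.
  rewrite (size_map_inj_poly pshift_inj (raddf0 _)).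
  apply: leq_trans (size_polyMleq _ _) _; rewrite size_XsubC addn2 /=.
  by rewrite ltnS; apply: leq_trans (leqSpred _) lt_d.
have : L.[1] = 0.
  by rewrite /L rmorphM rmorphB rmorph1 /= map_polyX hornerM !hornerE subrr mulr0.
rewrite (horner_coef_wide _ size_L) => sum0; rewrite -[RHS]sum0.
by apply: eq_bigr => i _; rewrite expr1n mulr1.
Qed.

Lemma order_scale_const (e : rat) (M : ore) :
  e != 0 -> order_ore (e%:P *: M) = order_ore M.
Proof.
rewrite -(polyC_eq0 e) => nz_e; congr _.-1.
exact: (size_scale (M : {poly {poly rat}}) nz_e).
Qed.

(** The witness [N] is [M] times the constant: constants are fixed by the
    coefficient shift, so they can be absorbed into the kernel.  The first two
    claims then hold for any lift of an operator of order 2. *)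
Lemma sigma_lift_order2 (e : rat) (M L : ore) :
    e != 0 -> order_ore M = 2%N -> L = e%:P *: sigma (M * (shift - 1)) ->
  [/\ order_ore L = 3%N,
      coef_ore L 0 + coef_ore L 1 + coef_ore L 2 + coef_ore L 3 = 0
    & exists2 N : ore, order_ore N = 2%N & L = sigma (N * (shift - 1))].
Proof.
move=> nz_e ordM ->; rewrite scale_sigma_lift.
have ordN : order_ore (e%:P *: M) = 2%N by rewrite order_scale_const.
set N := e%:P *: M in ordN *; split; last by exists N.
- by rewrite order_sigma_lift ordN.
have lt_N : (order_ore N < 3)%N by rewrite ordN.
by have := sum_coef_sigma_lift lt_N; rewrite !big_ord_recr big_ord0 /= add0r.
Qed.

(** Evaluation rules without the unit laws of [hornerE]: unifying the units 0
    and 1 with a rational numeral makes it compute in unary. *)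
Definition valueE := (pshift_horner, hornerMn, hornerD, hornerN, hornerM,
  hornerZ, horner_exp, hornerX, hornerC).

Lemma L2_1E : L2_1 = ore_of_seq [:: ('X + 1) ^+ 4;
  - ('X * (2 * 'X + 3) * (2 * 'X ^+ 2 + 6 * 'X + 5));
  4 * 'X * ('X + 1) * ('X + 2) ^+ 2].
Proof. by rewrite -ore_of_seq3E scaleNr. Qed.

Lemma L2_2E : L2_2 = ore_of_seq [:: ('X + 1) ^+ 3 * (3 * 'X + 4) * (3 * 'X + 7);
  (2 * 'X + 3) * (3 * 'X + 1) * (3 * 'X + 7) * (5 * 'X ^+ 2 + 15 * 'X + 12);
  16 * ('X + 2) ^+ 3 * (3 * 'X + 1) * (3 * 'X + 4)].
Proof. by rewrite -ore_of_seq3E. Qed.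

Lemma L2_GE : L2_G = ore_of_seq [:: ('X + 1) * ('X + 2); - (4 * ('X + 2) ^+ 2);
  (2 * 'X + 5) ^+ 2].
Proof. by rewrite -ore_of_seq3E scaleNr. Qed.

(** Used at points where the value is a small number, since rational numerals
    are compared in unary. *)
Lemma horner_neq0 (x : rat) (p : {poly rat}) : p.[x] != 0 -> p != 0.
Proof. by apply: contraNneq => ->; rewrite horner0. Qed.

Lemma order_L2_1 : order_ore L2_1 = 2%N.
Proof.
by rewrite L2_1E order_ore_of_seq //; apply: (@horner_neq0 1); rewrite !valueE.
Qed.

Lemma order_L2_2 : order_ore L2_2 = 2%N.
Proof.
by rewrite L2_2E order_ore_of_seq //; apply: (@horner_neq0 (-1));
  rewrite !valueE.
Qed.

Lemma order_L2_G : order_ore L2_G = 2%N.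
Proof.
by rewrite L2_GE order_ore_of_seq //; apply: (@horner_neq0 0); rewrite !valueE.
Qed.

Lemma L3_pi1_factor : L3_pi1 = (1 / 4)%:P *: sigma (L2_1 * (shift - 1)).
Proof.
by rewrite L2_1E sigma_lift_ore_of_seq3 /L3_pi1 ore_of_seq4E;
  congr (ore_of_seq [:: _; _; _; _]);
  apply: poly_eq_on_nat => m; rewrite !valueE; field.
Qed.

Lemma L3_pi2_factor : L3_pi2 = (1 / 144)%:P *: sigma (L2_2 * (shift - 1)).
Proof.
by rewrite L2_2E sigma_lift_ore_of_seq3 /L3_pi2 ore_of_seq4E;
  congr (ore_of_seq [:: _; _; _; _]);
  apply: poly_eq_on_nat => m; rewrite !valueE; field.
Qed.

Lemma L3_G_factor : L3_G = (1 / 4)%:P *: sigma (L2_G * (shift - 1)).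
Proof.
by rewrite L2_GE sigma_lift_ore_of_seq3 /L3_G ore_of_seq4E;
  congr (ore_of_seq [:: _; _; _; _]);
  apply: poly_eq_on_nat => m; rewrite !valueE; field.
Qed.

Definition ratr_valueE :=
  (rmorphD, rmorphN, rmorphM, rmorphXn, ratr_nat, rmorph1).

Lemma act_ore_of_seq3 (K : numFieldType) a b c (f : nat -> K) n :
  act (ore_of_seq [:: a; b; c]) f n =
  ratr a.[n%:R] * f n + ratr b.[n%:R] * f n.+1 + ratr c.[n%:R] * f n.+2.
Proof.
by rewrite act_ore_of_seq !big_ord_recr big_ord0 /= add0r addn0 addn1 addn2.
Qed.

Lemma annihilated_L2_G (K : numFieldType) (g : nat -> K) :
  annihilated L2_G g <->
  (forall n : nat,
     (2 * n%:R + 5) ^+ 2 * g n.+2 - 4 * (n%:R + 2) ^+ 2 * g n.+1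
     + (n%:R + 1) * (n%:R + 2) * g n = 0).
Proof.
have actE n : act L2_G g n =
     (2 * n%:R + 5) ^+ 2 * g n.+2 - 4 * (n%:R + 2) ^+ 2 * g n.+1
     + (n%:R + 1) * (n%:R + 2) * g n.
  by rewrite L2_GE act_ore_of_seq3 !valueE !ratr_valueE; ring.
by split=> h n; move: (h n); rewrite /= actE.
Qed.

(** The step ratio of the inflating weight is a polynomial, which is what keeps
    the recurrence polynomial.  Solving the kernel relation for its last term
    divides by 4 (n - 1) n (n + 1)^2; the factors 4 n (n + 1)^2 are absorbed by
    the ratio at [n] and the factor n - 1 by the ratio at [n - 1]. *)
Lemma weightS n : (0 < n)%N ->
  (4 ^ n.+1 * (n.+1.-1)`! * n.+1`! ^ 2 =
   4 * n * n.+1 ^ 2 * (4 ^ n * (n.-1)`! * n`! ^ 2))%N.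
Proof. by case: n => // n _; rewrite [_.-1]/= !factS !expnS expn0 /=; ring. Qed.

Lemma annihilated_L2_1_inflated (K : numFieldType) (c : nat -> K) :
  annihilated L2_1 c ->
  let u := fun n : nat => (4 ^ n * (n.-1)`! * n`! ^ 2)%N%:R * c n in
  forall n : nat, (2 <= n)%N ->
    u n.+1 = (2 * n%:R + 1) * (2 * n%:R ^+ 2 + 2 * n%:R + 1) * u n
             - 4 * n%:R ^+ 6 * u n.-1.
Proof.
move=> ann_c u [|n] // n_gt0; rewrite /u.
rewrite (weightS (ltn0Sn n)) (weightS n_gt0) [n.+1.-1]/=.
move: (4 ^ n * _ * _)%N => w; rewrite !(natrM, natrX).
rewrite -(@natr1 K n.+1) -(@natr1 K n).
have := ann_c n.
rewrite L2_1E act_ore_of_seq3 !valueE !ratr_valueE /= ratr_nat => rec.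
apply/eqP; rewrite -subr_eq0; apply/eqP.
(* The coefficient of [c n] is 4 (n+1)^6 w in the goal and (n+1)^4 in [rec],
   whence the multiplier. *)
transitivity (4 * (n%:R + 1) ^+ 2 * w%:R * 0 : K); last by rewrite mulr0.
by rewrite -rec; ring.
Qed.

Theorem theorem3p3 (K : numFieldType) :
  [/\ (* the common claim on the three operators *)
      (forall L : ore, L \in [:: L3_pi1; L3_pi2; L3_G] ->
         [/\ order_ore L = 3%N,
             coef_ore L 0 + coef_ore L 1 + coef_ore L 2 + coef_ore L 3 = 0
           & exists2 M : ore, order_ore M = 2%N & L = sigma (M * (shift - 1))]),
      (* (i) *)
      [/\ order_ore L2_1 = 2%N,
          L3_pi1 = (1 / 4)%:P *: sigma (L2_1 * (shift - 1))
        & forall c : nat -> K, annihilated L2_1 c ->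
          let u := fun n : nat =>
            (4 ^ n * (n.-1)`! * n`! ^ 2)%N%:R * c n in
          let recurrence := forall n : nat, (2 <= n)%N ->
            u n.+1 = (2 * n%:R + 1) * (2 * n%:R ^+ 2 + 2 * n%:R + 1) * u n
                     - 4 * n%:R ^+ 6 * u n.-1 in
          recurrence /\
          (recurrence <->
           represented_by_PCF ((2 * 'X + 1) * (2 * 'X ^+ 2 + 2 * 'X + 1))
             (- (4 * 'X ^+ 6)) 1 u)],
      (* (ii) *)
      order_ore L2_2 = 2%N /\
      L3_pi2 = (1 / 144)%:P *: sigma (L2_2 * (shift - 1))
    & (* (iii) *)
      [/\ order_ore L2_G = 2%N,
          L3_G = (1 / 4)%:P *: sigma (L2_G * (shift - 1))
        & forall g : nat -> K, annihilated L2_G g <->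
          (forall n : nat,
             (2 * n%:R + 5) ^+ 2 * g n.+2 - 4 * (n%:R + 2) ^+ 2 * g n.+1
             + (n%:R + 1) * (n%:R + 2) * g n = 0)]].
Proof.
split.
- move=> L; rewrite !inE => /or3P[] /eqP ->.
  + by apply: sigma_lift_order2 order_L2_1 L3_pi1_factor.
  + by apply: sigma_lift_order2 order_L2_2 L3_pi2_factor.
  + by apply: sigma_lift_order2 order_L2_G L3_G_factor.
- split; [exact: order_L2_1 | exact: L3_pi1_factor | move=> c ann_c u recurrence].
  split; first exact: annihilated_L2_1_inflated.
  have pcfE n : (2 <= n)%N ->
      ratr ((2 * 'X + 1) * (2 * 'X ^+ 2 + 2 * 'X + 1) : {poly rat}).[n%:R] * u n
      + ratr (- (4 * 'X ^+ 6) : {poly rat}).[n%:R] * u n.-1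
      = (2 * n%:R + 1) * (2 * n%:R ^+ 2 + 2 * n%:R + 1) * u n
        - 4 * n%:R ^+ 6 * u n.-1.
    by move=> _; rewrite !valueE !ratr_valueE; ring.
  by split=> h n n_gt1; move: (h n n_gt1); rewrite pcfE.
- by split; [exact: order_L2_2 | exact: L3_pi2_factor].
by split; [exact: order_L2_G | exact: L3_G_factor | exact: annihilated_L2_G].
Qed.
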